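(* Suppose that the random cocycle $\mathcal{R}=(\Omega,m,\sigma,\mathcal{B}_\omega,\tilde{\mathcal{L}}_{\omega,0})$ is admissible. Let $v:\Omega\times[0,1]\to\mathbb{R}$ be a nonnegative measurable observable, $v_\omega=v(\omega,\cdot)$, satisfying $\operatorname{ess\,sup}_\omega\|v_\omega\|_{\mathcal{B}_\omega}\le M$. Suppose that for $m$-a.e. $\omega\in\Omega$ $$E_{\omega,n}:=\sum_{k=0}^{n-1}\int v_{\sigma^k\omega}(x)\,d\mu_{\sigma^k\omega,0}(x)\to\infty,\qquad n\to\infty.$$ Then for $m$-a.e. $\omega\in\Omega$ $$\lim_{n\to\infty}\frac1{E_{\omega,n}}\sum_{k=0}^{n-1}v_{\sigma^k\omega}(T^k_\omega x)=1$$ for $\mu_{\omega,0}$-almost all $x$.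
   Context: Setting (closed random system). $(\Omega,\mathscr{F},m)$ is a probability space, $\sigma:\Omega\to\Omega$ is invertible, ergodic, $m$-preserving. $T_\omega:[0,1]\to[0,1]$ are surjective, finitely branched, piecewise monotone, nonsingular w.r.t. Lebesgue measure; $T_\omega^n=T_{\sigma^{n-1}\omega}\circ\cdots\circ T_\omega$; $T(\omega,x)=(\sigma\omega,T_\omega x)$. Weights $g_{\omega,0}\in\mathrm{BV}([0,1])$ with $\operatorname{ess\,sup}_\omega\|g_{\omega,0}\|_\infty<\infty$, $\operatorname{ess\,inf}_\omega\inf g_{\omega,0}>0$; $\operatorname{ess\,sup}_\omega|T'_\omega|<\infty$, $\operatorname{ess\,sup}_\omega\sup_y\#T_\omega^{-1}(y)<\infty$; for every subinterval $J$ there is $k(J)$ with $T_\omega^{k(J)}(J)=[0,1]$ for a.e. $\omega$; $\mathcal{L}_{\omega,0}f(x)=\sum_{y\in T_\omega^{-1}x}g_{\omega,0}(y)f(y)$; for some $n'\ge1$, $9\operatorname{ess\,sup}_\omega\|g^{(n')}_{\omega,0}\|_\infty<\operatorname{ess\,inf}_\omega\inf\mathcal{L}^{n'}_{\omega,0}\mathbf{1}$, where $g^{(n)}_{\omega,0}=\prod_{j<n}g_{\sigma^j\omega,0}\circ T^j_\omega$. $\nu_{\omega,0}$ are the fully supported, non-atomic random conformal probability measures, $\nu_{\sigma\omega,0}(\mathcal{L}_{\omega,0}f)=\lambda_{\omega,0}\nu_{\omega,0}(f)$, $\lambda_{\omega,0}=\nu_{\sigma\omega,0}(\mathcal{L}_{\omega,0}\mathbf{1})$;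 $\varphi_{\omega,0}>0$ satisfies $\mathcal{L}_{\omega,0}\varphi_{\omega,0}=\lambda_{\omega,0}\varphi_{\sigma\omega,0}$, $\nu_{\omega,0}(\varphi_{\omega,0})=1$; $\mu_{\omega,0}=\varphi_{\omega,0}\nu_{\omega,0}$. $\tilde{\mathcal{L}}_{\omega,0}=\lambda_{\omega,0}^{-1}\mathcal{L}_{\omega,0}$, $\tilde{\mathcal{L}}^n_{\omega,0}=\tilde{\mathcal{L}}_{\sigma^{n-1}\omega,0}\circ\cdots\circ\tilde{\mathcal{L}}_{\omega,0}$. $\mathcal{B}_\omega$ is the space of $\nu_{\omega,0}$-classes of BV functions with norm $\|f\|_{\mathcal{B}_\omega}=\mathrm{var}(f)+\nu_{\omega,0}(|f|)$ (variation minimized over the class). Admissible means: (i) $\sigma$ is a homeomorphism, $T$ is measurable and $\omega\mapsto T_\omega$ has countable range; (ii) there is $K$ independent of $\omega$ with $\|\tilde{\mathcal{L}}_{\omega,0}f\|_{\mathcal{B}_{\sigma\omega}}\le K\|f\|_{\mathcal{B}_\omega}$ for all $f\in\mathcal{B}_\omega$, $m$-a.e. $\omega$; (iii) there are $N\in\mathbb{N}$ and measurable $\tilde\alpha^N,\tilde\beta^N:\Omega\to(0,\infty)$ with $\int\log\tilde\alpha^N\,dm<0$ and $\|\tilde{\mathcal{L}}^N_{\omega,0}f\|_{\mathcal{B}_{\sigma^N\omega}}\le\tilde\alpha^N(\omega)\|f\|_{\mathcal{B}_\omega}+\tilde\beta^N(\omega)\|f\|_{L^1(\nu_{\omega,0})}$;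 (iv) there are $D>0$, $\kappa\in(0,1)$ with $\|\tilde{\mathcal{L}}^n_{\omega,0}f-\nu_{\omega,0}(f)\varphi_{\sigma^n\omega,0}\|_{\mathcal{B}_{\sigma^n\omega}}\le D\kappa^n\|f\|_{\mathcal{B}_\omega}$ for $m$-a.e. $\omega$ and all $n$; (v) $\operatorname{ess\,sup}_\omega\|\varphi_{\omega,0}\|_{\mathcal{B}_\omega}<\infty$, $\varphi_{\omega,0}\ge C^{-1}>0$ for $m$-a.e. $\omega$, and $|\mu_{\omega,0}((f\circ T^n_\omega)h)-\mu_{\sigma^n\omega,0}(f)\mu_{\omega,0}(h)|\le C\|f\|_\infty\|h\|_{\mathcal{B}_\omega}\kappa^n$. *)

(* Defs.v *)
From HB Require Import structures.
From mathcomp Require Import all_boot all_order all_algebra.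
From mathcomp Require Import all_classical all_reals all_analysis.
From mathcomp Require Import ess_sup_inf.
Set Implicit Arguments.
Unset Strict Implicit.
Unset Printing Implicit Defensive.
Import Order.TTheory GRing.Theory Num.Theory.
Import numFieldNormedType.Exports.
Local Open Scope classical_set_scope.
Local Open Scope ring_scope.

(* Maps and functions on [0,1] are represented by functions R -> R of which    *)
(* only the values on [0,1] matter; measures on [0,1] are Borel measures on R  *)
(* giving full mass to [0,1].                                                  *)

(* The base space carries a sigma-algebra and a topology (the latter is used   *)
(* only to say that the driving map is a homeomorphism). No compatibility      *)
(* between the two is imposed.                                                 *)
#[short(type="topMeasurableType")]
HB.structure Definition TopMeasurable d :=
  {T of Measurable d T & Topological T}.

Section BaseDynamics.
Context {d : measure_display} {R : realType} {Omega : measurableType d}.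
Implicit Types (m : probability Omega R) (sigma : Omega -> Omega).

Definition invertible_measurable sigma :=
  exists tau : Omega -> Omega, [/\ cancel sigma tau, cancel tau sigma,
    measurable_fun setT sigma & measurable_fun setT tau].

Definition measure_preserving m sigma :=
  forall A : set Omega, measurable A -> m (sigma @^-1` A) = m A.

Definition ergodic m sigma :=
  forall A : set Omega, measurable A -> sigma @^-1` A = A ->
    m A = 0%E \/ m A = 1%E.

End BaseDynamics.

Definition homeomorphism {X : topologicalType} (f : X -> X) :=
  exists g : X -> X, [/\ cancel f g, cancel g f, continuous f & continuous g].

(* F_{sigma^(n-1) omega} o ... o F_{sigma omega} o F_omega *)
Fixpoint cocycle {Omega A : Type} (sigma : Omega -> Omega)
    (F : Omega -> A -> A) (n : nat) (w : Omega) (a : A) : A :=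
  if n is n'.+1 then F (iter n' sigma w) (cocycle sigma F n' w a) else a.

Section Interval.
Context {R : realType}.
Local Notation I01 := (`[0%R, 1%R]%classic : set R).
Implicit Types (f : R -> R) (nu : {measure set R -> \bar R}).

(* True supremum on [0,1], not an essential one. *)
Definition sup_norm f : \bar R :=
  ereal_sup [set (`|f x|)%:E | x in I01].

Definition inf_val f : \bar R :=
  ereal_inf [set (f x)%:E | x in I01].

(* Finitely many branches, on each of which f is continuous and monotone.      *)
(* Strictness is not required here: for a nonsingular map a flat piece must be *)
(* a single point. Singletons are allowed among the Z i.                       *)
Definition piecewise_monotone f :=
  exists (n : nat) (Z : 'I_n -> set R),
    [/\ \bigcup_i Z i = I01,
        trivIset setT Z,
        forall i, is_interval (Z i),
        forall i, {within Z i, continuous f} &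
        forall i, {in Z i &, {homo f : x y / x <= y}} \/
                  {in Z i &, {homo f : x y /~ x <= y}}].

Definition nonsingular f :=
  forall A : set R, measurable A -> lebesgue_measure A = 0%E ->
    lebesgue_measure (I01 `&` f @^-1` A) = 0%E.

Definition L1_norm nu f : \bar R :=
  (\int[nu]_(x in I01) (`|f x|)%:E)%E.

Definition class_variation nu f : \bar R :=
  ereal_inf [set total_variation 0 1 h |
    h in [set h : R -> R | h = f %[ae nu in I01]]].

Definition B_norm nu f : \bar R := (class_variation nu f + L1_norm nu f)%E.

(* f represents an element of B: its nu-class contains a BV function. *)
Definition in_B nu f :=
  measurable_fun I01 f /\
  exists h : R -> R,
    bounded_variation 0 1 h /\ h = f %[ae nu in I01].

End Interval.

Section RandomSystem.
Context {R : realType} {d : measure_display} {Omega : topMeasurableType d}.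
Variables (m : probability Omega R) (sigma : Omega -> Omega).
Variables (T g : Omega -> R -> R).
Variables (nu : R.-pker Omega ~> R) (phi : Omega -> R -> R).
Variable mu : Omega -> probability R R.
Local Notation I01 := (`[0%R, 1%R]%classic : set R).
Implicit Types (w : Omega) (f h : R -> R) (n : nat).

Definition transfer w f : R -> R :=
  fun x => \sum_(y \in [set y | I01 y /\ T w y = x]) (g w y * f y).

Definition weight n w : R -> R :=
  fun x => \prod_(j < n) g (iter j sigma w) (cocycle sigma T j w x).

Definition lambda w : R :=
  \int[nu (sigma w)]_(x in I01) transfer w (cst 1) x.

Definition ntransfer w f : R -> R := fun x => (lambda w)^-1 * transfer w f x.

(* The derivative of T w is bounded in the L^oo(Lebesgue) norm on [0,1].       *)
(* [mu] is a parameter, determined for m-a.e. omega by [mu_density]. *)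
Record closed_random_system : Prop := ClosedRandomSystem {
  base_invertible : invertible_measurable sigma;
  base_preserving : measure_preserving m sigma;
  base_ergodic : ergodic m sigma;
  fiber_surjective : forall w, T w @` I01 = I01;
  fiber_monotone : forall w, piecewise_monotone (T w);
  fiber_nonsingular : forall w, nonsingular (T w);
  weight_BV : forall w, bounded_variation 0 1 (g w);
  weight_bounded : (ess_sup m (fun w => sup_norm (g w)) < +oo)%E;
  weight_positive : (0 < ess_inf m (fun w => inf_val (g w)))%E;
  (* T w is differentiable Lebesgue-a.e., being piecewise monotone *)
  fiber_derivative :
    (ess_sup m (fun w => ess_sup lebesgue_measure
       (fun x : R => (`|\1_I01 x * derive1 (T w) x|)%:E)) < +oo)%E;
  fiber_preimages : exists N : nat, {ae m, forall w, forall y : R, I01 y ->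
    ([set x | I01 x /\ T w x = y] #<= `I_N)%card};
  covering : forall J : set R, J `<=` I01 -> is_interval J ->
    (exists x y, [/\ J x, J y & x < y]) ->
    exists k : nat, {ae m, forall w, cocycle sigma T k w @` J = I01};
  contracting : exists n' : nat, (1 <= n')%N /\
    (9%:E * ess_sup m (fun w => sup_norm (weight n' w)) <
     ess_inf m (fun w => inf_val (cocycle sigma transfer n' w (cst (1%R : R)))))%E;
  nu_interval : {ae m, forall w, nu w I01 = 1%E};
  nu_full_support : {ae m, forall w, forall a b : R,
    0 <= a -> a < b -> b <= 1 -> (0 < nu w `]a, b[%classic)%E};
  nu_nonatomic : {ae m, forall w, forall x : R, nu w [set x] = 0%E};
  nu_conformal : {ae m, forall w, forall f, in_B (nu w) f ->
    \int[nu (sigma w)]_(x in I01) transfer w f x =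
    lambda w * \int[nu w]_(x in I01) f x};
  phi_measurable : {ae m, forall w, measurable_fun I01 (phi w)};
  phi_positive : {ae m, forall w, {ae nu w, forall x, I01 x -> 0 < phi w x}};
  phi_equivariant : {ae m, forall w, transfer w (phi w) =
    (fun x => lambda w * phi (sigma w) x) %[ae nu (sigma w) in I01]};
  phi_normalized : {ae m, forall w, \int[nu w]_(x in I01) phi w x = 1};
  mu_density : {ae m, forall w, forall A : set R, measurable A ->
    mu w A = (\int[nu w]_(x in A `&` I01) (phi w x)%:E)%E }
}.

Definition adm_base :=
  [/\ homeomorphism sigma,
      measurable_fun (setT `*` I01)
        (fun z : Omega * R => (sigma z.1, T z.1 z.2)) &
      countable (range (fun w => patch (cst 0) I01 (T w)))].

Definition adm_bounded := exists K : R,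
  {ae m, forall w, forall f, in_B (nu w) f ->
    (B_norm (nu (sigma w)) (ntransfer w f) <= K%:E * B_norm (nu w) f)%E}.

(* The integral of log alpha may be -oo, but its positive part has to be finite *)
(* (in the library, the integral of a function both of whose parts have        *)
(* infinite integral is -oo, and would satisfy the strict inequality).         *)
Definition adm_lasota_yorke := exists (N : nat) (alpha beta : Omega -> R),
  [/\ measurable_fun setT alpha /\ (forall w, 0 < alpha w),
      measurable_fun setT beta /\ (forall w, 0 < beta w),
      (\int[m]_w maxe (ln (alpha w))%:E 0 < +oo)%E,
      (\int[m]_w (ln (alpha w))%:E < 0)%E &
      {ae m, forall w, forall f, in_B (nu w) f ->
        (B_norm (nu (iter N sigma w)) (cocycle sigma ntransfer N w f) <=
         (alpha w)%:E * B_norm (nu w) f + (beta w)%:E * L1_norm (nu w) f)%E}].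

Definition adm_convergence (D kappa : R) :=
  {ae m, forall w, forall n f, in_B (nu w) f ->
    (B_norm (nu (iter n sigma w))
       (fun x => cocycle sigma ntransfer n w f x -
                 (\int[nu w]_(y in I01) f y) * phi (iter n sigma w) x)%R <=
     (D * kappa ^+ n)%:E * B_norm (nu w) f)%E}.

Definition adm_decay (C kappa : R) :=
  [/\ (ess_sup m (fun w => B_norm (nu w) (phi w)) < +oo)%E,
      {ae m, forall w, {ae nu w, forall x, I01 x -> C^-1 <= phi w x}} &
      {ae m, forall w, forall n f h,
        measurable_fun I01 f -> (sup_norm f < +oo)%E -> in_B (nu w) h ->
        (`| \int[mu w]_(x in I01) (f (cocycle sigma T n w x) * h x) -
             (\int[mu (iter n sigma w)]_(x in I01) f x) *
             (\int[mu w]_(x in I01) h x) |%R%:E <=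
         C%:E * sup_norm f * B_norm (nu w) h * (kappa ^+ n)%:E)%E}].

Definition admissible :=
  [/\ adm_base, adm_bounded, adm_lasota_yorke &
      exists D kappa C : R, [/\ 0 < D, 0 < kappa < 1, 0 < C,
        adm_convergence D kappa & adm_decay C kappa]].

Definition expected_sum (v : Omega -> R -> R) w n : R :=
  \sum_(k < n)
    \int[mu (iter k sigma w)]_(x in I01) v (iter k sigma w) x.

End RandomSystem.

(* Main.v *)
Require Import Defs.
From HB Require Import structures.
From mathcomp Require Import all_boot all_order all_algebra.
From mathcomp Require Import all_classical all_reals all_analysis.
From mathcomp Require Import ess_sup_inf measurable_realfun lra ring zify.
Set Implicit Arguments.
Unset Strict Implicit.
Unset Printing Implicit Defensive.
Import Order.TTheory GRing.Theory Num.Theory.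
Import numFieldNormedType.Exports.
Local Open Scope classical_set_scope.
Local Open Scope ring_scope.

(* Along a typical orbit write e_k for the mean of v_(sigma^k w), S_n for the     *)
(* orbit sums and E_n for the sum of the first n means. The decay of            *)
(* correlations started at sigma^(-j) w with h = 1, as j tends to infinity,      *)
(* shows that mu_w is sent exactly to mu_(sigma^n w) by T^n_w; applied again,    *)
(* it bounds the covariances of the summands by a geometric sequence, so that    *)
(* S_n has variance O(n) and (S_n - E_n) / n -> 0 almost surely along n = j^2,   *)
(* hence along all n since v is essentially bounded (a BV function is bounded    *)
(* by its norm).                                                                 *)
(* It remains to see that E_n grows linearly. No measurability of mu_w in w is   *)
(* given, but nu is a kernel, so w |-> nu_w(v_w) is measurable, and it is at     *)
(* most C e_0. By the maximal ergodic theorem and ergodicity, its Birkhoff sums  *)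
(* grow at least linearly unless it vanishes almost everywhere, in which case    *)
(* every E_n would be 0, as mu_w << nu_w.                                        *)

(** * A strong law under summable correlations *)

(** The quotient tends to 1 because S_n - E_n is o(n) while E_n is at least a positive multiple of
    n; [ratio_cvg1] joins the two facts. The first one is fiberwise: [fiber_invariance] identifies
    the means of the orbit summands, [trunc_obs_covariance] bounds their covariances, and
    [second_moment_sum_le] with [strong_law_second_moment] turns this into [orbit_strong_law]. The
    second one lives on the base: [maximal_ergodic] yields [ergodic_liminf_average], which is
    applied to the nu-means of the observable and carried to the mu-means by [Rintegral_nu_le_mu];
    [Rintegral_nu_eq0] and the divergence of E_n exclude nu-means that vanish almost everywhere. The
    integrals and moments are computed with the truncation [trunc_obs], which is bounded everywhere;
    by [ae_obs_orbit], almost every orbit does not see the difference. *)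

Section BoundedIntegrals.
Context {d : measure_display} {T : measurableType d} {R : realType}.
Variable P : probability T R.
Implicit Types (f g : T -> R) (B : R).

Lemma bounded_fun_integrable f B : measurable_fun setT f ->
  (forall x, `|f x| <= B) -> P.-integrable setT (EFin \o f).
Proof.
move=> mf fB; apply: measurable_bounded_integrable => //.
  by rewrite -ge0_fin_numE ?fin_num_measure.
exists B; split; first by rewrite num_real.
by move=> M BM x _; exact: le_trans (fB x) (ltW BM).
Qed.

Lemma cst_fun_integrable B : P.-integrable setT (EFin \o cst B).
Proof.
by apply: (@bounded_fun_integrable _ `|B|) => // x /=; exact: lexx.
Qed.

Lemma Rintegral_probability_cst B : \int[P]_x B = B.
Proof. by rewrite Rintegral_cst// [fine _](congr1 fine (probability_setT P)) mulr1. Qed.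

Lemma Rintegral_bounded_le f B : measurable_fun setT f ->
  (forall x, `|f x| <= B) -> \int[P]_x f x <= B.
Proof.
move=> mf fB; rewrite -[leRHS]Rintegral_probability_cst; apply: le_Rintegral => //.
- exact: bounded_fun_integrable mf fB.
- exact: cst_fun_integrable.
- by move=> x _; exact: le_trans (ler_norm _) (fB x).
Qed.

Lemma Rintegral_sum (I : Type) (s : seq I) (f : I -> T -> R) :
  (forall i, P.-integrable setT (EFin \o f i)) ->
  \int[P]_x (\sum_(i <- s) f i x) = \sum_(i <- s) \int[P]_x f i x.
Proof.
move=> fi; elim: s => [|i s IH].
  rewrite big_nil -[RHS](mul0r (fine (P setT))) -Rintegral_cst//.
  by apply: eq_Rintegral => x _; rewrite big_nil.
rewrite big_cons -IH -RintegralD//.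
  by apply: eq_Rintegral => x _; rewrite big_cons.
have := @integrable_sum _ _ _ P setT measurableT _ s xpredT
  (fun i x => (f i x)%:E) (fun i _ => fi i).
by congr (integrable _ _ _); apply/funext => x /=; rewrite sumEFin.
Qed.

End BoundedIntegrals.

Section SquareSubsequence.
Context {R : realType}.

Lemma nneseries_fin_cvg0 (u : R^nat) : (forall j, 0 <= u j) ->
  (\sum_(0 <= j <oo) (u j)%:E < +oo)%E -> u @ \oo --> 0.
Proof.
move=> u0 ufin; apply: cvg_series_cvg_0.
apply: nondecreasing_is_cvgn.
  by apply: nondecreasing_series => k _ _; exact: u0.
set L := (\sum_(0 <= j <oo) (u j)%:E)%E in ufin *.
exists (fine L) => _ [n _ <-].
have L0 : (0 <= L)%E by apply: nneseries_ge0 => k _ _; rewrite lee_fin.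
have Lfin : L \is a fin_num by rewrite ge0_fin_numE.
rewrite -lee_fin fineK// /series/= -sumEFin.
by apply: nneseries_lim_ge => k _ _; rewrite lee_fin.
Qed.

Lemma sum_inv_square_le n : \sum_(0 <= j < n) ((j.+1%:R : R) ^+ 2)^-1 <= 2.
Proof.
case: n => [|n]; first by rewrite big_geq.
(* The sharper bound makes the induction close, by the telescoping estimate 1/(k+1)^2 <= 1/k -
   1/(k+1). *)
suff: \sum_(0 <= j < n.+1) ((j.+1%:R : R) ^+ 2)^-1 <= 2 - n.+1%:R^-1.
  by move=> /le_trans; apply; rewrite lerBlDr lerDl invr_ge0.
elim: n => [|n IH]; first by rewrite big_nat1 expr1n invr1; lra.
rewrite big_nat_recr//=; apply: le_trans (lerD IH (lexx _)) _.
have n0 : (0 : R) < n.+1%:R by rewrite ltr0n.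
rewrite -[n.+2%:R]natr1; move: (n.+1%:R) n0 => x x0.
have x1 : 0 < x + 1 by lra.
rewrite -subr_ge0 [X in 0 <= X](_ : _ = (x * (x + 1) ^+ 2)^-1); last first.
  by field; rewrite !gt_eqF.
by rewrite invr_ge0 mulr_ge0 ?ltW// exprn_gt0.
Qed.

(** Between j^2 and (j+1)^2 there are at most 2j steps, so [s] moves by at most 2jB, which is
    negligible against n >= j^2. *)
Lemma cvg_div_squares (s : R^nat) (B : R) :
  (forall n, `|s n.+1 - s n| <= B) ->
  s (j.+1 ^ 2)%N / (j.+1 ^ 2)%:R @[j --> \oo] --> (0 : R) ->
  s n / n%:R @[n --> \oo] --> (0 : R).
Proof.
move=> sB sq0.
have B0 : 0 <= B := le_trans (normr_ge0 _) (sB 0%N).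
have sD k n : `|s (n + k)%N - s n| <= B * k%:R.
  elim: k => [|k IH]; first by rewrite addn0 subrr normr0 mulr0.
  rewrite addnS -natr1 mulrDr mulr1 (le_trans (ler_distD (s (n + k)%N) _ _))//.
  by rewrite addrC lerD.
apply/cvgr0Pnorm_le => e e0.
have e20 : 0 < e / 2 by rewrite divr_gt0.
have /cvgr0Pnorm_le/(_ _ e20)[N _ HN] := sq0.
(* The hypothesis is indexed by [j.+1], whence [N.+1]; the other entry gives 8B <= ej, so that the
   error 2jB is at most (e/4) j^2. *)
pose N' := (maxn N.+1 (Num.truncn (8 * B / e)).+1)%N.
exists (N' ^ 2)%N => // n /= N'n.
have N'0 : (0 < N')%N by rewrite /N' leq_max.
(* [j] is the integer square root of [n]. *)
have /sigW[j /andP[jn nj]] : exists j, (j ^ 2 <= n < j.+1 ^ 2)%N.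
  have ex0 : exists j, (j ^ 2 <= n)%N by exists 0%N.
  have bd j : (j ^ 2 <= n)%N -> (j <= n)%N.
    by move=> jn; apply: leq_trans jn; case: j => // j; rewrite leq_pmulr.
  case: (ex_maxnP ex0 bd) => j jn jmax; exists j; rewrite jn/= ltnNge.
  by apply/negP => jn1; have := jmax _ jn1; rewrite ltnn.
have N'j : (N' <= j)%N.
  rewrite -ltnS -(@ltn_exp2r _ _ 2)//; exact: leq_ltn_trans N'n nj.
have j0 : (0 < j)%N := leq_trans N'0 N'j.
have Nj : (N <= j.-1)%N.
  by rewrite -ltnS prednK//; apply: leq_trans N'j; rewrite leq_maxl.
have := HN _ Nj; rewrite /= prednK// => Hj.
have n0 : (0 < n)%N by apply: leq_trans jn; rewrite expn_gt0 j0.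
have jR : (0 : R) < j%:R by rewrite ltr0n.
have nR : (0 : R) < n%:R by rewrite ltr0n.
have j2n : (j%:R : R) * j%:R <= n%:R by rewrite -natrM ler_nat mulnn.
have Bj : 8 * B <= e * j%:R.
  rewrite [leRHS]mulrC -ler_pdivrMr//; apply: le_trans (ltW (truncnS_gt _)) _.
  by rewrite ler_nat; apply: leq_trans N'j; rewrite leq_maxr.
have sj : `|s (j ^ 2)%N| <= e / 2 * (j%:R * j%:R).
  move: Hj; rewrite normf_div [`|_%:R|]ger0_norm// natrX expr2.
  by rewrite ler_pdivrMr// mulr_gt0.
have sn : `|s n - s (j ^ 2)%N| <= B * (2 * j%:R).
  have := sD (n - j ^ 2)%N (j ^ 2)%N; rewrite subnKC// => /le_trans; apply.
  rewrite ler_wpM2l// -natrM ler_nat leq_subLR.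
  rewrite -ltnS; apply: leq_trans nj _.
  by rewrite !expnS !expn0 !muln1 mulSn mulnS mul2n -addnn; lia.
rewrite normf_div [`|n%:R|]ger0_norm// ler_pdivrMr//.
have -> : s n = (s n - s (j ^ 2)%N) + s (j ^ 2)%N by rewrite subrK.
apply: le_trans (ler_normD _ _) _; apply: le_trans (lerD sn sj) _.
have : e / 2 * (j%:R * j%:R) <= e / 2 * n%:R by rewrite ler_wpM2l// ltW.
have : 8 * B * j%:R <= e * j%:R * j%:R by rewrite ler_wpM2r// ltW.
have : e * (j%:R * j%:R) <= e * n%:R by rewrite ler_wpM2l// ltW.
rewrite -mulrA; nra.
Qed.

(** The distance of S/E from 1 is |S - E|/n times n/E, and the last factor is at most 1/c. *)
Lemma ratio_cvg1 (S E : R^nat) (c : R) : 0 < c ->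
  (\forall n \near \oo, c * n%:R <= E n) ->
  (S n - E n) / n%:R @[n --> \oo] --> (0 : R) ->
  (E n)^-1 * S n @[n --> \oo] --> (1 : R).
Proof.
move=> c0 cE /cvgr0Pnorm_le SE; apply/cvgrPdist_le => e e0; near=> n.
have n0 : (0 : R) < n%:R.
  by rewrite ltr0n; near: n; exists 1%N.
have cEn : c * n%:R <= E n by near: n.
have E0 : 0 < E n by apply: lt_le_trans cEn; exact: mulr_gt0.
have : `|(S n - E n) / n%:R| <= e * c by near: n; apply: SE; exact: mulr_gt0.
rewrite normf_div [`|n%:R|]gtr0_norm// ler_pdivrMr// -mulrA => SEn.
have -> : 1 - (E n)^-1 * S n = - ((S n - E n) / E n) by field; rewrite gt_eqF.
rewrite normrN normf_div [`|E n|]gtr0_norm// ler_pdivrMr//.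
by apply: le_trans SEn _; rewrite ler_wpM2l// ltW.
Unshelve. all: by end_near. Qed.

End SquareSubsequence.

Section StrongLaw.
Context {d : measure_display} {T : measurableType d} {R : realType}.
Variables (P : probability T R) (X : nat -> T -> R) (B : R).
Hypothesis mX : forall k, measurable_fun setT (X k).
Hypothesis XB : forall k x, `|X k x| <= B.

Let S n x := \sum_(k < n) X k x.

Let mS n : measurable_fun setT (S n).
Proof. by apply: measurable_sum => k; exact: mX. Qed.

Let S_le n x : `|S n x| <= B * n%:R.
Proof.
apply: le_trans (ler_norm_sum _ _ _) _.
apply: (le_trans (y := \sum_(k < n) B)); first exact: ler_sum.
by rewrite sumr_const card_ord mulr_natr.
Qed.

Let mul_integrable (f g : T -> R) (C D : R) :
  measurable_fun setT f -> measurable_fun setT g ->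
  (forall x, `|f x| <= C) -> (forall x, `|g x| <= D) ->
  P.-integrable setT (EFin \o (fun x => f x * g x)).
Proof.
move=> mf mg fC gD; apply: (@bounded_fun_integrable _ _ _ _ _ (C * D)).
  exact: measurable_funM.
by move=> x; rewrite normrM ler_pM.
Qed.

(** Passing from n to n+1 terms adds twice the correlations of the new term with the old ones and
    its own second moment; the geometric decay bounds this increment uniformly in n. *)
Lemma second_moment_sum_le (K kappa : R) : 0 < kappa < 1 ->
  (forall k l, (k <= l)%N -> \int[P]_x (X k x * X l x) <= K * kappa ^+ (l - k)) ->
  forall n, \int[P]_x (\sum_(k < n) X k x) ^+ 2 <= n%:R * (2 * K / (1 - kappa)).
Proof.
move=> /andP[k0 k1] cov.
have K0 : 0 <= K.
  apply: le_trans (_ : \int[P]_x (X 0%N x * X 0%N x) <= _).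
    by apply: Rintegral_ge0 => x _; rewrite -expr2 sqr_ge0.
  by have := cov 0%N 0%N (leqnn _); rewrite expr0 mulr1.
(* The geometric sum is at most kappa/(1-kappa), so the left side is at most
   K(1+kappa)/(1-kappa). *)
have geo n : 2 * (K * \sum_(k < n) kappa ^+ (n - k)) + K <= 2 * K / (1 - kappa).
  have k10 : 0 < 1 - kappa by lra.
  suff H : (1 - kappa) * \sum_(k < n) kappa ^+ (n - k) <= kappa.
    rewrite ler_pdivlMr//; nra.
  suff -> : (1 - kappa) * \sum_(k < n) kappa ^+ (n - k) = kappa - kappa ^+ n.+1.
    by rewrite lerBlDr lerDl exprn_ge0// ltW.
  elim: n => [|n IH]; first by rewrite big_ord0 mulr0 expr1 subrr.
  rewrite big_ord_recl/= subn0 mulrDr.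
  under eq_bigr do rewrite /bump/= add1n subSS.
  by rewrite IH !exprS; ring.
elim=> [|n IH].
  rewrite mul0r (@eq_Rintegral _ _ _ P setT (cst 0)) ?Rintegral_cst ?mul0r//.
  by move=> x _; rewrite big_ord0 expr0n.
have iSS : P.-integrable setT (EFin \o (fun x => S n x * S n x)).
  exact: mul_integrable (S_le n) (S_le n).
have iSX : P.-integrable setT (EFin \o (fun x => S n x * X n x)).
  exact: mul_integrable (S_le n) (XB n).
have iXX k l : P.-integrable setT (EFin \o (fun x => X k x * X l x)).
  exact: mul_integrable (XB k) (XB l).
have -> : \int[P]_x (\sum_(k < n.+1) X k x) ^+ 2 =
    \int[P]_x (S n x * S n x + (2 * (S n x * X n x) + X n x * X n x)).
  by apply: eq_Rintegral => x _; rewrite big_ord_recr/= -/(S n x); ring.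
have i2SX : P.-integrable setT (EFin \o (fun x => 2 * (S n x * X n x))).
  apply: (@mul_integrable (cst 2) _ 2 (B * n%:R * B)) => //.
  - exact: measurable_funM.
  - by move=> x; rewrite /= ger0_norm.
  - by move=> x; rewrite normrM ler_pM.
rewrite RintegralD//; last first.
  have := @integrableD _ _ _ P setT measurableT _ _ i2SX (iXX n n).
  by congr (integrable _ _ _); apply/funext => x /=; rewrite EFinD.
rewrite RintegralD// RintegralZl//.
have -> : \int[P]_x (S n x * X n x) = \sum_(k < n) \int[P]_x (X k x * X n x).
  rewrite -Rintegral_sum//.
  by apply: eq_Rintegral => x _; rewrite /S mulr_suml.
rewrite -[n.+1%:R]natr1 [leRHS]mulrDl [1 * _ in leRHS]mul1r; apply: lerD.
  by apply: le_trans IH; rewrite le_eqVlt; apply/orP; left; apply/eqP/eq_Rintegral.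
apply: le_trans (geo n); apply: lerD.
  rewrite ler_wpM2l// mulr_sumr; apply: ler_sum => k _; exact/cov/ltnW/ltn_ord.
by have := cov n n (leqnn _); rewrite subnn expr0 mulr1.
Qed.

(** Along n = (j+1)^2 the second moments of the averages are summable. By monotone convergence the
    series of squared averages is integrable, hence finite almost everywhere, and its terms tend to
    0; [cvg_div_squares] fills the gaps between squares. *)
Lemma strong_law_second_moment (V : R) :
  (forall n, \int[P]_x (\sum_(k < n) X k x) ^+ 2 <= n%:R * V) ->
  {ae P, forall x, (\sum_(k < n) X k x) / n%:R @[n --> \oo] --> (0 : R)}.
Proof.
move=> SV.
have V0 : 0 <= V.
  rewrite -[V]mul1r; apply: le_trans (SV 1%N).
  by apply: Rintegral_ge0 => x _; rewrite sqr_ge0.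
pose N j : nat := (j.+1 ^ 2)%N.
have N0 j : 0 < ((N j)%:R : R) by rewrite ltr0n expn_gt0.
pose f j x := (S (N j) x / (N j)%:R) ^+ 2.
have mf j : measurable_fun setT (f j).
  apply: measurable_funX; apply: measurable_funM => //.
have f0 j x : 0 <= f j x by rewrite sqr_ge0.
have fB j x : `|f j x| <= B ^+ 2.
  rewrite normrX ler_sqr ?nnegrE//; last exact: le_trans (XB 0%N x).
  by rewrite normf_div [`|_%:R|]ger0_norm// ler_pdivrMr.
(* The second moment of the sum is at most V times [N j], and it is divided by the square of
   [N j]. *)
have intf j : (\int[P]_x (f j x)%:E <= (V * ((j.+1%:R : R) ^+ 2)^-1)%:E)%E.
  have if_ := bounded_fun_integrable P (mf j) (fB j).
  rewrite -[leLHS]fineK; last exact: integrable_fin_num.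
  rewrite lee_fin -/(Rintegral _ _ _).
  have -> : Rintegral P setT (f j) = (N j)%:R ^- 2 * \int[P]_x (S (N j) x) ^+ 2.
    rewrite -RintegralZl//; last first.
      by rewrite /=; under eq_fun do rewrite expr2; exact: mul_integrable.
    by apply: eq_Rintegral => x _; rewrite /f expr_div_n mulrC.
  apply: le_trans (ler_wpM2l _ (SV (N j))) _; first by rewrite invr_ge0 sqr_ge0.
  by rewrite mulrA [_ * V]mulrC ler_wpM2l// /N natrX expr2 invfM -mulrA mulVf ?mulr1//.
have fin : (\int[P]_x (\sum_(0 <= j <oo) (f j x)%:E) < +oo)%E.
  rewrite integral_nneseries//=; last 2 first.
  - by move=> n; exact/measurable_EFinP.
  - by move=> n x _; rewrite lee_fin.
  apply: (@le_lt_trans _ _ (V * 2)%:E); last exact: ltry.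
  apply: lime_le.
    apply: is_cvg_nneseries => n _ _.
    by apply: integral_ge0 => x _; rewrite lee_fin.
  near=> n.
  apply: le_trans (lee_sum _ (fun j _ => intf j)) _.
  by rewrite sumEFin lee_fin -mulr_sumr ler_wpM2l// sum_inv_square_le.
have : P.-integrable setT (fun x => (\sum_(0 <= j <oo) (f j x)%:E)%E).
  apply/integrableP; split.
    apply: ge0_emeasurable_sum => //; first by move=> k x _ _; rewrite lee_fin.
    by move=> k _; exact/measurable_EFinP.
  rewrite (eq_integral (fun x => (\sum_(0 <= j <oo) (f j x)%:E)%E))// => x _.
  by rewrite gee0_abs// nneseries_ge0// => n _ _; rewrite lee_fin.
move=> /(integrable_ae measurableT); apply: filterS => x /(_ I) fx.
apply: (@cvg_div_squares _ (S ^~ x) B).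
  by move=> n; rewrite /S big_ord_recr/= addrAC subrr add0r.
have f_0 : f ^~ x @ \oo --> 0.
  apply: nneseries_fin_cvg0 => //.
  by rewrite -ge0_fin_numE// nneseries_ge0// => n _ _; rewrite lee_fin.
have : (fun j => Num.sqrt (f j x)) @ \oo --> Num.sqrt 0.
  by apply: continuous_cvg => //; exact: sqrt_continuous.
rewrite sqrtr0 /f => h; apply: norm_cvg0.
by move: h; under eq_fun do rewrite sqrtr_sqr.
Unshelve. all: by end_near. Qed.

End StrongLaw.

(** * Linear growth of nonnegative Birkhoff sums *)

Lemma Rintegral_measure_preserving {d d' : measure_display}
    {X : measurableType d} {Y : measurableType d'} {R : realType}
    (P : probability X R) (Q : probability Y R) (h : X -> Y) :
  measurable_fun setT h ->
  (forall A, measurable A -> P (h @^-1` A) = Q A) ->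
  forall (f : Y -> R) (B : R), measurable_fun setT f ->
  (forall y, `|f y| <= B) -> \int[P]_x f (h x) = \int[Q]_y f y.
Proof.
move=> mh PQ f B mf fB; rewrite /Rintegral; congr fine.
have mfh : measurable_fun setT (fun x => f (h x)) by exact: measurableT_comp.
rewrite -(@eq_measure_integral _ _ _ setT Q (pushforward P h)); last first.
  by move=> A mA _; rewrite /= -PQ.
rewrite integral_pushforward//; first exact/measurable_EFinP.
by rewrite preimage_setT; exact: (bounded_fun_integrable P mfh (fun x => fB _)).
Qed.

Lemma birkhoff_sumS {Omega : Type} {V : zmodType} (sigma : Omega -> Omega)
    (f : Omega -> V) n w : \sum_(k < n.+1) f (iter k sigma w) =
  f w + \sum_(k < n) f (iter k sigma (sigma w)).
Proof.
rewrite big_ord_recl/=; congr (_ + _).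
by apply: eq_bigr => k _; rewrite -iterSr.
Qed.

Section MaximalErgodic.
Context {d : measure_display} {Omega : measurableType d} {R : realType}.
Variables (m : probability Omega R) (sigma : Omega -> Omega).
Hypothesis msigma : measurable_fun setT sigma.
Hypothesis sigma_preserving : measure_preserving m sigma.

Lemma measurable_iter k : measurable_fun setT (iter k sigma).
Proof.
elim: k => [|k IH]; first exact: measurable_id.
exact: (measurableT_comp msigma IH).
Qed.

(** The exceptional set is a countable union of preimages of one null set, each null by
    invariance. *)
Lemma ae_iter (P : Omega -> Prop) : {ae m, forall w, P w} ->
  {ae m, forall w, forall k, P (iter k sigma w)}.
Proof.
move=> [A [mA A0 PA]]; apply: ae_foralln => k.
exists (iter k sigma @^-1` A); split.
- by rewrite -[X in measurable X]setTI; exact: measurable_iter.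
- elim: k => //= k IH; rewrite -IH -[RHS]sigma_preserving//; last first.
    by rewrite -[X in measurable X]setTI; exact: measurable_iter.
  by congr (m _); apply/seteqP; split => w /=; rewrite -iterSr.
- by move=> w /= nP; apply: PA.
Qed.

Section BirkhoffSums.
Variables (f : Omega -> R) (B : R).
Hypothesis mf : measurable_fun setT f.
Hypothesis fB : forall w, `|f w| <= B.

Let S n w := \sum_(k < n) f (iter k sigma w).

Let SS n w : S n.+1 w = f w + S n (sigma w).
Proof. exact: birkhoff_sumS. Qed.

(* [F n] is the maximum of the Birkhoff sums of length at most [n]. *)
Let F := fix F n w := if n is n'.+1 then Num.max 0 (f w + F n' (sigma w)) else 0.

Let F_ge0 n w : 0 <= F n w.
Proof. by case: n => //= n; rewrite le_max lexx. Qed.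

Let F_le n w : F n w <= B * n%:R.
Proof.
elim: n w => [|n IH] w /=; first by rewrite mulr0.
have B0 : 0 <= B := le_trans (normr_ge0 _) (fB w).
rewrite ge_max mulr_ge0//= -natr1 mulrDr mulr1 addrC lerD//.
exact: le_trans (ler_norm _) (fB w).
Qed.

Let mF n : measurable_fun setT (F n).
Proof.
elim: n => [|n IH] /=; first exact: measurable_cst.
apply: measurable_maxr => //; apply: measurable_funD => //.
exact: measurableT_comp.
Qed.

Let F_nondecreasing n w : F n w <= F n.+1 w.
Proof.
elim: n w => [|n IH] w; first exact: F_ge0.
by rewrite /= le_max2// lerD.
Qed.

Let S_le_F n w : S n w <= F n w.
Proof.
elim: n w => [|n IH] w; first by rewrite /S big_ord0.
by rewrite SS /= le_max lerD2l IH orbT.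
Qed.

Let F_mono w : {homo F ^~ w : n p / (n <= p)%N >-> n <= p}.
Proof. exact: homo_leq (@lexx _ _) (@le_trans _ _) (fun n => F_nondecreasing n w). Qed.

(* Garsia's proof: integrate [F - F \o sigma <= f] over [F > 0]. *)
Lemma maximal_ergodic :
  {ae m, forall w, exists n, 0 < \sum_(k < n) f (iter k sigma w)} ->
  0 <= \int[m]_w f w.
Proof.
move=> Spos.
pose g n w := f w * \1_[set w | 0 < F n w] w.
have mpos n : measurable [set w | 0 < F n w].
  have := mF n measurableT (measurable_itv `]0, +oo[); rewrite setTI.
  by congr measurable; apply/seteqP; split => w /=; rewrite in_itv/= andbT.
have mg n : measurable_fun setT (g n).
  by apply: measurable_funM => //; exact: measurable_indic.
have gB n w : `|g n w| <= B.
  rewrite /g indicE; case: (_ \in _); rewrite ?mulr1// mulr0 normr0.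
  exact: le_trans (normr_ge0 _) (fB w).
have ig n := bounded_fun_integrable m (mg n) (gB n).
have Fn n w : `|F n w| <= B * n%:R by rewrite ger0_norm.
have iF n := bounded_fun_integrable m (mF n) (Fn n).
have iFs n := bounded_fun_integrable m (measurableT_comp (mF n) msigma)
  (fun w => Fn n (sigma w)).
(* By invariance the integral of [F n.+1 - F n.+1 \o sigma] is 0. Where [F n.+1] is positive, it
   equals [f + F n \o sigma], at most [f + F n.+1 \o sigma]; elsewhere it is 0 and the difference is
   at most 0. *)
have g0 n : 0 <= \int[m]_w g n.+1 w.
  apply: (@le_trans _ _ (\int[m]_w (F n.+1 w - F n.+1 (sigma w)))).
    rewrite RintegralB//; last exact: iFs.
    rewrite (Rintegral_measure_preserving msigma sigma_preserving (mF _) (Fn n.+1)).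
    by rewrite subrr.
  apply: le_Rintegral => //.
    have := @integrableB _ _ _ m setT measurableT _ _ (iF n.+1) (iFs n.+1).
    by congr (integrable _ _ _); apply/funext => w /=; rewrite EFinB.
  move=> w _; rewrite /g indicE; have [Fpos|Fneg] := ltP 0 (F n.+1 w).
    rewrite mem_set// mulr1 lerBlDr; apply: (@le_trans _ _ (f w + F n (sigma w))).
      by move: Fpos; rewrite /= lt_max ltxx/= => /ltW/max_idPr ->.
    by rewrite lerD2l.
  rewrite memNset ?mulr0; last by apply/negP; rewrite -leNgt.
  by rewrite subr_le0 (le_trans Fneg).
(* Almost every point eventually has a positive [F], so the cut-off functions [g] become equal to
   [f] there, and dominated convergence applies with bound [B]. *)
have cvg_g : {ae m, forall w, setT w ->
    (g n.+1 w)%:E @[n --> \oo] --> (f w)%:E}.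
  apply: filterS Spos => w [n Sn] _; apply: cvg_near_cst.
  exists n => // p /= np; rewrite /g indicE mem_set ?mulr1//=.
  by apply: lt_le_trans Sn _; apply: le_trans (S_le_F n w) (F_mono w (leqW np)).
have [_ _ cvg_int] := @dominated_convergence _ _ _ m setT measurableT
  (fun n w => (g n.+1 w)%:E) (EFin \o f) (EFin \o cst B)
  (fun n => (measurable_EFinP _ _).2 (mg n.+1)) ((measurable_EFinP _ _).2 mf)
  cvg_g (cst_fun_integrable m B)
  (aeW _ (fun w n _ => gB n.+1 w)).
apply: fine_ge0; rewrite -(cvg_lim _ cvg_int)//; apply: lime_ge.
  by apply/cvg_ex; eexists; exact: cvg_int.
apply: nearW => n /=; rewrite -(fineK (integrable_fin_num measurableT (ig n.+1))).
by rewrite lee_fin; exact: g0.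
Qed.

End BirkhoffSums.

(** The set [A] on which the lower limit of the averages is 0 is invariant, so it is null or of full
    measure. Off [A] some 1/(j+1) serves as [c]. If [A] had full measure, then for each e > 0 almost
    every point would have a positive Birkhoff sum of [e - f], and the maximal ergodic theorem would
    give an integral of [f] at most e. *)
Lemma ergodic_liminf_average (f : Omega -> R) (B : R) : ergodic m sigma ->
  measurable_fun setT f -> (forall w, 0 <= f w <= B) -> 0 < \int[m]_w f w ->
  {ae m, forall w, exists2 c, 0 < c & exists N, forall n, (N <= n)%N ->
    c * n%:R <= \sum_(k < n) f (iter k sigma w)}.
Proof.
move=> erg mf f0B intf.
have B0 : 0 <= B by have /andP[f0 /(le_trans f0)] := f0B point.
pose S n w := \sum_(k < n) f (iter k sigma w).
have SS n w : S n.+1 w = f w + S n (sigma w) by exact: birkhoff_sumS.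
have S0 n w : 0 <= S n w.
  by apply: sumr_ge0 => k _; have /andP[] := f0B (iter k sigma w).
have mS n : measurable_fun setT (S n).
  by apply: measurable_sum => k; exact: measurableT_comp (measurable_iter k).
pose low (j : nat) n := [set w | j.+1%:R * S n w < n%:R].
have mlow j n : measurable (low j n).
  rewrite -[low j n]setTI; apply: measurable_fun_ltr => //.
  exact: measurable_funM.
pose A := [set w | forall j N, exists2 n, (N <= n)%N & low j n w].
have mA : measurable A.
  have -> : A = \bigcap_j \bigcap_N \bigcup_(n in [set n | (N <= n)%N]) low j n.
    apply/seteqP; split=> [w Aw j _ N _|w Aw j N].
      by have [n Nn lw] := Aw j N; exists n.
    by have [n /= Nn lw] := Aw j I N I; exists n.
  apply: bigcap_measurable => // j _; apply: bigcap_measurable => // N _.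
  exact: bigcup_measurable.
have Asigma : sigma @^-1` A = A.
  apply/seteqP; split => w Aw j N.
  (* Half of the allowance pays for the sum from [sigma w], by doubling the index; the other half
     pays for the extra term [f w <= B], by taking n > 2(j+1)B. *)
  - pose j' := (j.+1).*2; pose N' := maxn N (Num.truncn (2 * j.+1%:R * B)).+1.
    have [n] := Aw j' N'; rewrite /N' geq_max => /andP[Nn Bn] lown.
    exists n.+1; first exact: leqW.
    rewrite /low/= SS; move: lown; rewrite /low/= /j'.
    have := truncnS_gt (2 * j.+1%:R * B).
    have nB : ((Num.truncn (2 * j.+1%:R * B)).+1%:R : R) <= n%:R by rewrite ler_nat.
    move=> /lt_le_trans/(_ nB) {nB}.
    have := S0 n (sigma w); have /andP[f0 fB] := f0B w.
    rewrite -[n.+1%:R]natr1 -[(j.+1.*2).+1%:R]natr1 -mul2n natrM.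
    have : (0 : R) < j.+1%:R by rewrite ltr0n.
    move: (j.+1%:R) (n%:R) (S n _) => x y s; nra.
  (* Dropping [f w >= 0] only lowers the sum; [N.+2] leaves n >= 1 after removing one step, and n +
     1 <= 2n is absorbed by the doubled index. *)
  - pose j' := j.+1; have [n Nn lown] := Aw j'.*2 N.+2.
    case: n Nn lown => // n Nn lown; exists n; first exact: ltnW.
    move: lown; rewrite /low/= SS.
    have n1 : (1 : R) <= n%:R by rewrite ler1n; case: n Nn.
    have := S0 n (sigma w); have /andP[f0 fB] := f0B w.
    rewrite -[n.+1%:R]natr1 -[(j'.*2).+1%:R]natr1 -mul2n natrM.
    have : (0 : R) < j.+1%:R by rewrite ltr0n.
    move: n1 (S n _); rewrite /j'; move: (j.+1%:R) (n%:R) => x y ? s; nra.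
have [A0|A1] := erg A mA Asigma.
  exists A; split => // w /= nw j N; apply: contrapT => nlow; apply: nw.
  exists j.+1%:R^-1; first by rewrite invr_gt0.
  exists N => n Nn; rewrite mulrC ler_pdivrMr// leNgt mulrC.
  by apply/negP => lw; apply: nlow; exists n.
suff : \int[m]_w f w <= 0 by rewrite leNgt intf.
apply/ler_addgt0Pr => e e0; rewrite add0r.
(* Chosen so that 1/(j+1) < e. *)
pose j := Num.truncn e^-1.
have mge : measurable_fun setT (fun w => e - f w) by exact: measurable_funB.
have geB w : `|e - f w| <= e + B.
  have /andP[f0 fB] := f0B w; apply: le_trans (ler_normB _ _) _.
  by rewrite !ger0_norm ?lerD// ltW.
have ie : m.-integrable setT (EFin \o cst e).
  exact: cst_fun_integrable.
have if_ : m.-integrable setT (EFin \o f).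
  apply: (bounded_fun_integrable m mf (B := B)) => w.
  by have /andP[? ?] := f0B w; rewrite ger0_norm.
have : 0 <= \int[m]_w (e - f w).
  apply: (maximal_ergodic mge geB); exists (~` A); split.
  - exact: measurableC.
  - by rewrite probability_setC// A1 subee.
  - move=> w nP Aw; apply: nP; have [n _ lown] := Aw j 0%N; exists n.
    rewrite sumrB sumr_const card_ord -mulr_natr subr_gt0.
    have ej : 1 < e * j.+1%:R by rewrite -ltr_pdivrMl// mulr1 truncnS_gt.
    rewrite -(@ltr_pM2l _ j.+1%:R) ?ltr0n//; apply: lt_le_trans lown _.
    by rewrite mulrA [j.+1%:R * e]mulrC ler_peMl// ltW.
by rewrite RintegralB// Rintegral_probability_cst subr_ge0.
Qed.

End MaximalErgodic.

(** * Functions of bounded variation on the unit interval *)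

Section UnitInterval.
Context {R : realType}.
Local Notation I01 := (`[0%R, 1%R]%classic : set R).
Implicit Types (f h : R -> R).

Lemma dist_le_total_variation f x y : I01 x -> I01 y ->
  (`|f x - f y|%:E <= total_variation 0 1 f)%E.
Proof.
wlog xy : x y / x <= y.
  move=> wl Ix Iy; have [|/ltW] := leP x y; first by move=> /wl; apply.
  by move=> /wl; rewrite distrC; apply.
rewrite /= !in_itv/= => /andP[x0 x1] /andP[y0 y1]; rewrite distrC.
apply: le_trans (total_variation_ge f xy) _.
rewrite (@total_variationD _ 0 1 x f)// (@total_variationD _ x 1 y f)//.
by rewrite addeCA leeDl// adde_ge0// total_variation_ge0.
Qed.

Lemma B_norm_cst1_le (nu : {measure set R -> \bar R}) : nu I01 = 1%E ->
  (B_norm nu (cst 1%R) <= 1)%E.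
Proof.
move=> nu1; rewrite -[leRHS]add0e; apply: leeD.
  apply: ereal_inf_lbound; exists (cst 1); first exact: aeW.
  by rewrite nondecreasing_total_variation// subrr.
rewrite /L1_norm; under eq_integral do rewrite /= normr1.
by rewrite integral_cst// mul1e nu1.
Qed.

Lemma in_B_cst1 (nu : {measure set R -> \bar R}) : in_B nu (cst 1).
Proof.
split; first exact: measurable_cst.
exists (cst 1); split; last exact: aeW.
by apply/bounded_variationP => //; rewrite nondecreasing_total_variation.
Qed.

Lemma L1_norm_ge0 (nu : {measure set R -> \bar R}) f : (0 <= L1_norm nu f)%E.
Proof. by apply: integral_ge0 => x _; rewrite lee_fin. Qed.

Lemma class_variation_ge0 (nu : {measure set R -> \bar R}) f :
  (0 <= class_variation nu f)%E.
Proof.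
by apply: le_ereal_inf_tmp => _ [h _ <-]; exact: total_variation_ge0.
Qed.

Lemma B_norm_ge0 (nu : {measure set R -> \bar R}) f : (0 <= B_norm nu f)%E.
Proof. exact: adde_ge0 (class_variation_ge0 nu f) (L1_norm_ge0 nu f). Qed.

Lemma sup_norm_le f (D : R) : (forall x, I01 x -> `|f x| <= D) ->
  (0 <= sup_norm f <= D%:E)%E.
Proof.
move=> fD; apply/andP; split.
  apply: (@le_trans _ _ (`|f 0|)%:E); first by rewrite lee_fin.
  by apply: ereal_sup_ubound; exists 0; rewrite //= in_itv/= lexx ler01.
by apply: ge_ereal_sup => _ [x Ix <-]; rewrite lee_fin fD.
Qed.

Section BNorm.
Variables (nu : {measure set R -> \bar R}) (f : R -> R) (M : R).
Hypothesis nu1 : nu I01 = 1%E.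
Hypothesis mf : measurable_fun I01 f.
Hypothesis fM : (B_norm nu f <= M%:E)%E.

(** The class variation is an infimum that need not be attained; the slack 1 allowed here is the
    source of the bound [M + 1] below. *)
Lemma B_norm_BV_representative : exists h,
  [/\ h = f %[ae nu in I01], total_variation 0 1 h \is a fin_num &
      (total_variation 0 1 h + L1_norm nu f < (M + 1)%:E)%E].
Proof.
have L1_fin : L1_norm nu f \is a fin_num.
  rewrite ge0_fin_numE ?L1_norm_ge0 ?class_variation_ge0//.
  apply: le_lt_trans (ltry M); apply: le_trans fM.
  exact/leeDr/class_variation_ge0.
have cv_fin : class_variation nu f \is a fin_num.
  rewrite ge0_fin_numE ?L1_norm_ge0 ?class_variation_ge0//.
  apply: le_lt_trans (ltry M); apply: le_trans fM.
  exact/leeDl/L1_norm_ge0.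
have [_ [h hf <-] hlt] := lb_ereal_inf_adherent ltr01 cv_fin.
exists h; split => //.
  rewrite ge0_fin_numE ?total_variation_ge0// (lt_trans hlt)//.
  by rewrite lte_add_pinfty ?ltry// -ge0_fin_numE ?class_variation_ge0.
apply: lt_le_trans (_ : (class_variation nu f + 1 + L1_norm nu f <= _)%E).
  by rewrite lte_leD.
by rewrite addeAC EFinD leeD2r.
Qed.

Lemma B_norm_in_B : in_B nu f.
Proof.
split => //; have [h [hf hfin _]] := B_norm_BV_representative.
by exists h; split => //; exact/bounded_variationP.
Qed.

(** For a representative h, |h x| <= |h x - h y| + |h y| is at most the variation plus |f y| for
    almost every y; integrating over y against the probability [nu] bounds |h x| at every point. *)
Lemma B_norm_ae_le : {ae nu, forall x, I01 x -> `|f x| <= M + 1}.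
Proof.
have [h [hf hfin hlt]] := B_norm_BV_representative.
have hle x : I01 x -> `|h x| <= M + 1.
  move=> Ix; rewrite -lee_fin; apply: le_trans (ltW hlt).
  have mabs : measurable_fun I01 (fun y => (`|f y|)%:E).
    by apply/measurable_EFinP; exact: measurableT_comp.
  have -> : ((`|h x|)%:E = \int[nu]_(y in I01) (`|h x|)%:E)%E.
    by rewrite integral_cst// nu1 mule1.
  have -> : (total_variation 0 1 h + L1_norm nu f =
      \int[nu]_(y in I01) ((fine (total_variation 0 1 h))%:E + (`|f y|)%:E))%E.
    rewrite ge0_integralD//; last first.
      by move=> y _; rewrite lee_fin fine_ge0// total_variation_ge0.
    by rewrite integral_cst// nu1 mule1 fineK.
  apply: ae_ge0_le_integral => //.
  - by move=> y _; rewrite adde_ge0// ?lee_fin// fine_ge0// total_variation_ge0.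
  - by apply: emeasurable_funD.
  - apply: filterS hf => y hy Iy; rewrite fineK//.
    have := dist_le_total_variation h Ix Iy; rewrite -hy//.
    move: (total_variation 0 1 h) hfin => [r||]//= _; rewrite !lee_fin.
    by have := ler_distD (h y) (h x) 0; rewrite !subr0; lra.
by apply: filterS hf => x hx Ix; rewrite -hx//; exact: hle.
Qed.

End BNorm.

End UnitInterval.

(** * Fibers of the random system *)

Section Cocycle.
Context {Omega A : Type} (sigma : Omega -> Omega) (F : Omega -> A -> A).

Lemma cocycleD p n w a : cocycle sigma F (p + n)%N w a =
  cocycle sigma F p (iter n sigma w) (cocycle sigma F n w a).
Proof. by elim: p => //= p IH; rewrite IH iterD. Qed.

End Cocycle.

Section MeasureOnUnitInterval.
Context {R : realType}.
Local Notation I01 := (`[0%R, 1%R]%classic : set R).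

Lemma Rintegral_unit_interval (mu : probability R R) (f g : R -> R) :
  mu (~` I01) = 0%E -> measurable_fun I01 f -> measurable_fun setT g ->
  {ae mu, forall x, I01 x -> f x = g x} ->
  \int[mu]_(x in I01) f x = \int[mu]_x g x.
Proof.
move=> mu0 mf mg fg; rewrite Rintegral_mkcond /Rintegral; congr fine.
apply: ae_eq_integral => //.
- apply/measurable_EFinP. exact: (measurable_restrictT f _).1.
- exact/measurable_EFinP.
have out : {ae mu, forall x, I01 x}.
  by exists (~` I01); split => //; exact: measurableC.
by apply: filterS2 out fg => x Ix fgx _; rewrite patchE mem_set// fgx.
Qed.

End MeasureOnUnitInterval.

Section RandomFibers.
Context {R : realType} {d : measure_display} {Omega : topMeasurableType d}.
Variables (sigma tau : Omega -> Omega).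
Variables (T : Omega -> R -> R) (nu : R.-pker Omega ~> R) (phi : Omega -> R -> R).
Variables (mu : Omega -> probability R R) (v : Omega -> R -> R) (C kappa M : R).
Local Notation I01 := (`[0%R, 1%R]%classic : set R).
Hypothesis C0 : 0 < C.
Hypothesis kappa01 : 0 < kappa < 1.
Hypothesis sigmaK : cancel tau sigma.
Hypothesis mT : forall w, measurable_fun I01 (T w).
Hypothesis TI : forall w x, I01 x -> I01 (T w x).
Hypothesis mv : forall w, measurable_fun I01 (v w).
Hypothesis v0 : forall w x, I01 x -> 0 <= v w x.

(** Gathers the almost sure properties of one fiber, so that the argument along an orbit can be
    carried out for a fixed base point. *)
Record good_fiber (w : Omega) : Prop := GoodFiber {
  good_nu : nu w I01 = 1%E;
  good_phi_meas : measurable_fun I01 (phi w);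
  good_phi_ge : {ae nu w, forall x, I01 x -> C^-1 <= phi w x};
  good_density : forall A : set R, measurable A ->
    mu w A = (\int[nu w]_(x in A `&` I01) (phi w x)%:E)%E;
  good_decay : forall n f h,
    measurable_fun I01 f -> (sup_norm f < +oo)%E -> in_B (nu w) h ->
    (`| \int[mu w]_(x in I01) (f (cocycle sigma T n w x) * h x) -
        (\int[mu (iter n sigma w)]_(x in I01) f x) *
        (\int[mu w]_(x in I01) h x) |%R%:E <=
     C%:E * sup_norm f * B_norm (nu w) h * (kappa ^+ n)%:E)%E;
  good_obs : (B_norm (nu w) (v w) <= M%:E)%E }.

(* The fiber maps and the observable, extended by 0 to total Borel functions; *)
(* the truncation only changes the observable on a null set of each fiber.    *)
Definition ext_map w : R -> R := T w \_ I01.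
Definition trunc_obs w : R -> R :=
  (fun x => Num.min (v w x) (`|M| + 1)) \_ I01.

Local Notation That n w := (cocycle sigma ext_map n w).

Lemma ext_map_in w x : I01 x -> ext_map w x = T w x.
Proof. by move=> Ix; rewrite /ext_map patchE mem_set. Qed.

Lemma ext_cocycle n w x : I01 x ->
  That n w x = cocycle sigma T n w x /\ I01 (That n w x).
Proof.
move=> Ix; elim: n => //= n [IH1 IH2].
by rewrite ext_map_in// -IH1; split=> //; exact: TI.
Qed.

Lemma measurable_ext_cocycle n w : measurable_fun setT (That n w).
Proof.
elim: n => [|n IH] /=; first exact: measurable_id.
apply: measurableT_comp IH; exact: (measurable_restrictT _ _).1.
Qed.

Lemma measurable_trunc_obs w : measurable_fun setT (trunc_obs w).
Proof. by apply: (measurable_restrictT _ _).1 => //; exact: measurable_minr. Qed.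

Lemma trunc_obs_ge0_le w x : 0 <= trunc_obs w x <= `|M| + 1.
Proof.
rewrite /trunc_obs patchE; have [/set_mem Ix|_] := boolP (x \in I01).
  by rewrite le_min v0//= ge_min lexx orbT addr_ge0.
by rewrite lexx/= addr_ge0.
Qed.

Lemma trunc_obs_norm w x : `|trunc_obs w x| <= `|M| + 1.
Proof. by have /andP[? ?] := trunc_obs_ge0_le w x; rewrite ger0_norm. Qed.

Section GoodFiber.
Variable w : Omega.
Hypothesis Hw : good_fiber w.

Lemma mu_unit_intervalC : mu w (~` I01) = 0%E.
Proof.
by rewrite (good_density Hw) ?setICl ?integral_set0//; exact: measurableC.
Qed.

Lemma mu_dominates_nu A : measurable A -> nu w A = 0%E -> mu w A = 0%E.
Proof.
move=> mA nA; rewrite (good_density Hw)//; apply: null_set_integral => //.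
- exact: measurableI.
- apply/measurable_EFinP; apply: measurable_funS (good_phi_meas Hw) => //.
- by apply: (@subset_measure0 _ _ _ _ _ A) => //; exact: measurableI.
Qed.

Lemma ae_nu_ae_mu (P : R -> Prop) : {ae nu w, forall x, P x} ->
  {ae mu w, forall x, P x}.
Proof.
by move=> [A [mA A0 PA]]; exists A; split => //; exact: mu_dominates_nu.
Qed.

Lemma nu_unit_interval A : measurable A -> nu w (A `&` I01) = nu w A.
Proof.
move=> mA; have nuC : nu w (~` I01) = 0%E.
  have : nu w setT = (nu w (setT `\` I01) + nu w (setT `&` I01))%E.
    exact: measureDI.
  rewrite setTD setTI (good_nu Hw) prob_kernel => /esym/eqP.
  by case: (nu w _) => [r||]//=; rewrite -EFinD eqe => /eqP r1; congr EFin; lra.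
have -> : nu w A = (nu w (A `\` I01) + nu w (A `&` I01))%E by exact: measureDI.
rewrite (_ : nu w (A `\` _) = 0%E) ?add0e//.
apply: (@subset_measure0 _ _ _ _ _ (~` I01)) => //.
- exact: measurableD.
- exact: measurableC.
Qed.

Lemma nu_le_mu A : measurable A -> ((C^-1)%:E * nu w A <= mu w A)%E.
Proof.
move=> mA; rewrite -nu_unit_interval// (good_density Hw)//.
have mAI : measurable (A `&` I01) by exact: measurableI.
have mphi : measurable_fun (A `&` I01) (phi w).
  exact: measurable_funS (good_phi_meas Hw).
(* The density may be negative on a null set; its positive part makes the comparison of nonnegative
   integrals applicable. *)
have mphi0 : measurable_fun (A `&` I01) (fun x => Num.max 0 (phi w x)).
  exact: measurable_maxr.
rewrite [leRHS](ae_eq_integral (fun x => (Num.max 0 (phi w x))%:E))//.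
- rewrite -integral_cst//; apply: ae_ge0_le_integral => //.
  + by move=> x _; rewrite lee_fin invr_ge0 ltW.
  + by move=> x _; rewrite lee_fin le_max lexx.
  + exact/measurable_EFinP.
  + apply: filterS (good_phi_ge Hw) => x hx [_ Ix].
    by rewrite lee_fin le_max hx ?orbT.
- exact/measurable_EFinP.
- exact/measurable_EFinP.
- apply: filterS (good_phi_ge Hw) => x hx [_ Ix]; congr EFin; apply/esym/max_idPr.
  by apply: le_trans (hx Ix); rewrite invr_ge0 ltW.
Qed.

Lemma trunc_obs_ae_nu : {ae nu w, forall x, I01 x -> v w x = trunc_obs w x}.
Proof.
apply: filterS (B_norm_ae_le (good_nu Hw) (mv w) (good_obs Hw)) => x vx Ix.
rewrite /trunc_obs patchE mem_set//; apply/esym/min_idPl.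
apply: le_trans (ler_norm _) _; apply: le_trans (vx Ix) _.
by rewrite lerD2r ler_norm.
Qed.

Lemma Rintegral_obs :
  \int[mu w]_(x in I01) v w x = \int[mu w]_x trunc_obs w x.
Proof.
apply: Rintegral_unit_interval => //; first exact: mu_unit_intervalC.
  exact: measurable_trunc_obs.
exact/ae_nu_ae_mu/trunc_obs_ae_nu.
Qed.

End GoodFiber.

(** Restates the decay for total Borel functions. The pair [h], [hh] lets the observable supply the
    norm while its truncation is the function integrated. *)
Lemma decay_ext w n (f h hh : R -> R) (D K : R) :
  good_fiber w -> good_fiber (iter n sigma w) ->
  measurable_fun setT f -> (forall x, `|f x| <= D) ->
  in_B (nu w) h -> (B_norm (nu w) h <= K%:E)%E ->
  measurable_fun setT hh -> {ae mu w, forall x, I01 x -> h x = hh x} ->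
  `| \int[mu w]_x (f (That n w x) * hh x) -
     \int[mu (iter n sigma w)]_x f x * \int[mu w]_x hh x | <=
  C * D * K * kappa ^+ n.
Proof.
move=> Hw Hn mf fD hB hK mhh hhh.
have mfI : measurable_fun I01 f by exact: measurable_funS mf.
have /andP[s0 sD] := sup_norm_le (fun x (_ : I01 x) => fD x).
have sfin : (sup_norm f < +oo)%E by apply: le_lt_trans sD _; exact: ltry.
have mcoc : measurable_fun I01 (cocycle sigma T n w).
  apply: eq_measurable_fun (measurable_funS _ _ (measurable_ext_cocycle n w)) => //.
  by move=> x /set_mem Ix; have [] := ext_cocycle n w Ix.
have := good_decay Hw n mfI sfin hB.
have mu0 := mu_unit_intervalC Hw.
rewrite (@Rintegral_unit_interval _ (mu (iter n sigma w)) f f)//; last 2 first.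
- exact: mu_unit_intervalC Hn.
- exact: aeW.
rewrite (@Rintegral_unit_interval _ (mu w) h hh)//; last exact: hB.1.
rewrite (@Rintegral_unit_interval _ (mu w) _ (fun x => f (That n w x) * hh x))//.
- move=> H; rewrite -lee_fin; apply: le_trans H _.
  have k0 : 0 <= kappa ^+ n by rewrite exprn_ge0// ltW//; case/andP: kappa01.
  rewrite !EFinM; apply: lee_wpmul2r; first by rewrite lee_fin.
  apply: lee_pmul => //.
  - by rewrite mule_ge0// lee_fin ltW.
  - exact: B_norm_ge0.
  - by apply: lee_wpmul2l => //; rewrite lee_fin ltW.
- apply: measurable_funM; last exact: hB.1.
  exact: measurableT_comp.
- apply: measurable_funM => //; apply: measurableT_comp => //.
  exact: measurable_ext_cocycle.
- apply: filterS hhh => x hx Ix; have [-> _] := ext_cocycle n w Ix.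
  by rewrite hx.
Qed.

(** Start at [iter j tau w] with h = 1. The integral of f along n + j steps is within a multiple of
    kappa^j of the left side, viewed as j steps followed by a fixed function, and of the right side,
    viewed as n + j steps. Then j tends to infinity. *)
Lemma fiber_invariance w n (f : R -> R) (D : R) :
  (forall j, good_fiber (iter j tau w)) -> good_fiber (iter n sigma w) ->
  measurable_fun setT f -> (forall x, `|f x| <= D) ->
  \int[mu w]_x f (That n w x) = \int[mu (iter n sigma w)]_x f x.
Proof.
move=> Htau Hn mf fD; apply/eqP; rewrite -subr_eq0 -normr_eq0 eq_le normr_ge0 andbT.
have sK j : iter j sigma (iter j tau w) = w.
  by elim: j => // j IH; rewrite iterSr /= sigmaK.
have one_ae j : {ae mu (iter j tau w), forall x, I01 x -> (cst 1 : R -> R) x = cst 1 x}.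
  exact: aeW.
have D0 : 0 <= D := le_trans (normr_ge0 _) (fD 0).
have bound j : `|\int[mu w]_x f (That n w x) - \int[mu (iter n sigma w)]_x f x|
    <= (2 * (C * D)) * kappa ^+ j.
  have Hj := Htau j; have nu1 := good_nu Hj.
  have k0 p : 0 <= kappa ^+ p by rewrite exprn_ge0// ltW//; case/andP: kappa01.
  have H1 := @decay_ext (iter j tau w) j (fun x => f (That n w x)) (cst 1) (cst 1)
    D 1 Hj.
  have H2 := @decay_ext (iter j tau w) (n + j)%N f (cst 1) (cst 1) D 1 Hj.
  move: H1 H2; rewrite iterD !sK => H1 H2.
  have {}H1 := H1 (Htau 0%N) (measurableT_comp mf (measurable_ext_cocycle n w))
    (fun x => fD _) (in_B_cst1 _) (B_norm_cst1_le nu1) (@measurable_cst _ _ _ _ _ _)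
    (one_ae j).
  have {}H2 := H2 Hn mf fD (in_B_cst1 _) (B_norm_cst1_le nu1)
    (@measurable_cst _ _ _ _ _ _) (one_ae j).
  move: H1 H2; rewrite Rintegral_probability_cst !mulr1.
  have -> : \int[mu (iter j tau w)]_x (f (That (n + j)%N (iter j tau w) x) * cst 1 x) =
     \int[mu (iter j tau w)]_x (f (That n w (That j (iter j tau w) x)) * cst 1 x).
    by apply: eq_Rintegral => x _; rewrite cocycleD sK.
  move: (\int[_]_x (_ * _)) => I H1 H2.
  have : C * D * kappa ^+ (n + j)%N <= C * D * kappa ^+ j.
    rewrite ler_wpM2l ?(mulr_ge0 (ltW C0))// exprD ler_piMl//.
    by rewrite exprn_ile1// ltW//; case/andP: kappa01.
  have := ler_distD I (\int[mu w]_x f (That n w x)) (\int[mu (iter n sigma w)]_x f x).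
  rewrite [in X in _ <= X -> _]distrC; lra.
have : (2 * (C * D)) * kappa ^+ j @[j --> \oo] --> (2 * (C * D)) * (0 : R).
  apply: cvgMr => //; apply: cvg_expr; case/andP: kappa01 => k0 k1.
  by rewrite ger0_norm// ltW.
rewrite mulr0 => cvg0; rewrite -(cvg_lim _ cvg0)//.
apply: limr_ge; first by apply/cvg_ex; eexists; exact: cvg0.
exact: nearW.
Qed.

(** * Covariances and the strong law along one orbit *)

Section Orbit.
Variable w : Omega.
Hypothesis Htau : forall k j, good_fiber (iter j tau (iter k sigma w)).
Let Hsigma k : good_fiber (iter k sigma w) := Htau k 0%N.

Let Y k x := trunc_obs (iter k sigma w) (That k w x).
Let e k := \int[mu (iter k sigma w)]_x trunc_obs (iter k sigma w) x.

Lemma Rintegral_trunc_obs_ge0_le k : 0 <= e k <= `|M| + 1.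
Proof.
rewrite /e Rintegral_ge0 => [|x _]; last first.
  by have /andP[] := trunc_obs_ge0_le (iter k sigma w) x.
apply: Rintegral_bounded_le; [exact: measurable_trunc_obs|exact: trunc_obs_norm].
Qed.

(** Invariance moves the product moment to the fiber over [iter k sigma w], where only [l - k] steps
    remain, and makes the means equal to [e k] and [e l]; the decay then applies with an observable
    of norm at most [M]. *)
Lemma trunc_obs_covariance k l : (k <= l)%N ->
  \int[mu w]_x ((Y k x - e k) * (Y l x - e l)) <=
  C * (`|M| + 1) * M * kappa ^+ (l - k).
Proof.
move=> kl; pose wk := iter k sigma w.
have lE : iter l sigma w = iter (l - k) sigma wk by rewrite -iterD subnK.
have mY j : measurable_fun setT (Y j).
  exact: measurableT_comp (measurable_trunc_obs _) (measurable_ext_cocycle _ _).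
have YB j x : `|Y j x| <= `|M| + 1 by exact: trunc_obs_norm.
have iY j := bounded_fun_integrable (mu w) (mY j) (YB j).
have mYY : measurable_fun setT (fun x => Y k x * Y l x) by exact: measurable_funM.
have YYB x : `|Y k x * Y l x| <= (`|M| + 1) * (`|M| + 1) by rewrite normrM ler_pM.
have iYY := bounded_fun_integrable (mu w) mYY YYB.
have IY j : \int[mu w]_x Y j x = e j.
  exact: (fiber_invariance (fun i => Htau 0%N i) (Hsigma j)
    (measurable_trunc_obs _) (trunc_obs_norm _)).
have IYY : \int[mu w]_x (Y k x * Y l x) = \int[mu wk]_x
    (trunc_obs (iter l sigma w) (That (l - k)%N wk x) * trunc_obs wk x).
  rewrite -(@fiber_invariance w k _ ((`|M| + 1) * (`|M| + 1)))//.
  - apply: eq_Rintegral => x _; rewrite mulrC; congr (_ * _).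
    by rewrite /Y -cocycleD subnK.
  - by move=> j; exact: (Htau 0%N).
  - apply: measurable_funM; last exact: measurable_trunc_obs.
    exact: measurableT_comp (measurable_trunc_obs _) (measurable_ext_cocycle _ _).
  - by move=> x; rewrite normrM ler_pM// trunc_obs_norm.
have -> : \int[mu w]_x ((Y k x - e k) * (Y l x - e l)) =
    \int[mu w]_x (Y k x * Y l x) - e l * e k.
  have mZ a j : measurable_fun setT (fun x => a * Y j x) by exact: measurable_funM.
  have ZB a j x : `|a * Y j x| <= `|a| * (`|M| + 1) by rewrite normrM ler_wpM2l.
  have iZ a j := bounded_fun_integrable (mu w) (mZ a j) (ZB a j).
  have icst := cst_fun_integrable (mu w) (e k * e l).
  have i1 : (mu w).-integrable setT (EFin \o (fun x => Y k x * Y l x - e l * Y k x)).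
    apply: (@bounded_fun_integrable _ _ _ _ _
      ((`|M| + 1) * (`|M| + 1) + `|e l| * (`|M| + 1))); first exact: measurable_funB.
    by move=> x; rewrite (le_trans (ler_normB _ _))// lerD.
  have i2 : (mu w).-integrable setT (EFin \o (fun x => e k * Y l x - e k * e l)).
    apply: (@bounded_fun_integrable _ _ _ _ _
      (`|e k| * (`|M| + 1) + `|e k * e l|)); first exact: measurable_funB.
    by move=> x; rewrite (le_trans (ler_normB _ _))// lerD.
  transitivity (\int[mu w]_x ((Y k x * Y l x - e l * Y k x) -
      (e k * Y l x - e k * e l))).
    by apply: eq_Rintegral => x _; ring.
  rewrite RintegralB// RintegralB// RintegralB//.
  by rewrite Rintegral_probability_cst !RintegralZl// !IY; ring.
rewrite IYY; apply: le_trans (ler_norm _) _.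
have := @decay_ext wk (l - k)%N (trunc_obs (iter l sigma w)) (v wk) (trunc_obs wk)
  (`|M| + 1) M (Hsigma k).
rewrite -lE; apply => //.
- exact: measurable_trunc_obs.
- exact: trunc_obs_norm.
- exact: B_norm_in_B (mv _) (good_obs (Hsigma k)).
- exact: good_obs (Hsigma k).
- exact: measurable_trunc_obs.
- exact/(ae_nu_ae_mu (Hsigma k))/(trunc_obs_ae_nu (Hsigma k)).
Qed.

Lemma measure_preimage_cocycle k A : measurable A ->
  mu w (That k w @^-1` A) = mu (iter k sigma w) A.
Proof.
move=> mA.
have mpre : measurable (That k w @^-1` A).
  by rewrite -[X in measurable X]setTI; exact: measurable_ext_cocycle.
have indicB x : `|(\1_A x : R)| <= 1.
  by rewrite indicE; case: (_ \in _); rewrite ?normr1 ?normr0.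
have mindic : measurable_fun setT (\1_A : R -> R) by exact: measurable_indic.
have := fiber_invariance (fun j => Htau 0%N j) (Hsigma k) mindic indicB.
rewrite /Rintegral.
rewrite (_ : (fun x => (\1_A (That k w x))%:E) =
    (fun x => (\1_(That k w @^-1` A) x)%:E)); last first.
  by apply/funext => x; rewrite !indicE.
rewrite !integral_indic// !setIT => H.
by rewrite -[LHS]fineK ?fin_num_measure// H fineK// fin_num_measure.
Qed.

(** At each time the truncation acts on a null set of the current fiber, whose preimage is null for
    [mu w] by invariance; there are countably many times. *)
Lemma ae_obs_orbit : {ae mu w, forall x, I01 x -> forall k,
  v (iter k sigma w) (cocycle sigma T k w x) = Y k x}.
Proof.
have : {ae mu w, forall x, forall k, I01 (That k w x) ->
    v (iter k sigma w) (That k w x) = Y k x}.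
  apply: ae_foralln => k.
  have [A [mA A0 PA]] := ae_nu_ae_mu (Hsigma k) (trunc_obs_ae_nu (Hsigma k)).
  exists (That k w @^-1` A); split.
  - by rewrite -[X in measurable X]setTI; exact: measurable_ext_cocycle.
  - exact: etrans (measure_preimage_cocycle k mA) A0.
  - by move=> x nx; apply: PA.
apply: filterS => x vY Ix k.
by have [<- Ik] := ext_cocycle k w Ix; exact: vY.
Qed.

Lemma expected_sumE n : expected_sum sigma mu v w n = \sum_(k < n) e k.
Proof. by apply: eq_bigr => k _; exact: Rintegral_obs. Qed.

Lemma orbit_strong_law : {ae mu w, forall x, I01 x ->
  (\sum_(k < n) v (iter k sigma w) (cocycle sigma T k w x) -
   expected_sum sigma mu v w n) / n%:R @[n --> \oo] --> (0 : R)}.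
Proof.
pose X k x := Y k x - e k.
have mX k : measurable_fun setT (X k).
  apply: measurable_funB => //.
  exact: measurableT_comp (measurable_trunc_obs _) (measurable_ext_cocycle _ _).
have XB k x : `|X k x| <= (`|M| + 1) + (`|M| + 1).
  rewrite (le_trans (ler_normB _ _))// lerD//; first exact: trunc_obs_norm.
  by have /andP[e0 eM] := Rintegral_trunc_obs_ge0_le k; rewrite ger0_norm.
have moment := second_moment_sum_le mX XB kappa01 trunc_obs_covariance.
have := strong_law_second_moment mX XB moment.
apply: filterS2 ae_obs_orbit => x vY Xx Ix.
under eq_fun => n do rewrite expected_sumE -sumrB.
under eq_fun => n do under eq_bigr => k _ do rewrite vY//.
exact: Xx.
Qed.

End Orbit.

(** * Comparison of the nu-means and mu-means of the observable *)

Lemma trunc_obs_integrable_nu w :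
  (nu w).-integrable setT (EFin \o trunc_obs w).
Proof.
apply: measurable_bounded_integrable => //.
- by rewrite prob_kernel ltry.
- exact: measurable_trunc_obs.
- exists (`|M| + 1); split; first by rewrite num_real.
  by move=> D MD x _; exact: le_trans (trunc_obs_norm w x) (ltW MD).
Qed.

Lemma Rintegral_nu_obs_ge0_le w :
  0 <= \int[nu w]_x trunc_obs w x <= `|M| + 1.
Proof.
have u0 x : 0 <= trunc_obs w x by have /andP[] := trunc_obs_ge0_le w x.
rewrite Rintegral_ge0//= -lee_fin fineK; last first.
  exact: (integrable_fin_num measurableT (trunc_obs_integrable_nu w)).
apply: (@le_trans _ _ (\int[nu w]_x (`|M| + 1)%:E)%E).
  apply: ge0_le_integral => //.
  - by move=> x _; rewrite lee_fin.
  - by apply/measurable_EFinP; exact: measurable_trunc_obs.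
  - by move=> x _; rewrite lee_fin; have /andP[] := trunc_obs_ge0_le w x.
by rewrite integral_cst// prob_kernel mule1.
Qed.

(** By [nu_le_mu] the measure [nu w] scaled by [C^-1] lies below [mu w], and integrals of
    nonnegative functions are monotone in the measure. *)
Lemma Rintegral_nu_le_mu w : good_fiber w ->
  C^-1 * \int[nu w]_x trunc_obs w x <= \int[mu w]_x trunc_obs w x.
Proof.
move=> Hw.
have mE : measurable_fun setT (fun x => (trunc_obs w x)%:E).
  by apply/measurable_EFinP; exact: measurable_trunc_obs.
have u0 x : (0 <= (trunc_obs w x)%:E)%E.
  by rewrite lee_fin; have /andP[] := trunc_obs_ge0_le w x.
have ci0 : 0 <= C^-1 by rewrite invr_ge0 ltW.
have imu := bounded_fun_integrable (mu w) (measurable_trunc_obs w) (trunc_obs_norm w).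
rewrite -lee_fin EFinM fineK; last first.
  exact: (integrable_fin_num measurableT (trunc_obs_integrable_nu w)).
rewrite fineK; last exact: (integrable_fin_num measurableT imu).
have <- := @ge0_integral_mscale _ _ _ (nu w) setT measurableT (NngNum ci0) _ mE
  (fun x _ => u0 x).
by apply: ge0_le_measure_integral => // A mA; exact: nu_le_mu.
Qed.

(** A nonnegative function with zero nu-integral vanishes nu-almost everywhere, hence mu-almost
    everywhere. *)
Lemma Rintegral_nu_eq0 w : good_fiber w -> \int[nu w]_x trunc_obs w x = 0 ->
  \int[mu w]_x trunc_obs w x = 0.
Proof.
move=> Hw nu0.
have mE : measurable_fun setT (fun x => (trunc_obs w x)%:E).
  by apply/measurable_EFinP; exact: measurable_trunc_obs.
have absE (Q : {measure set R -> \bar R}) :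
    (\int[Q]_x `|(trunc_obs w x)%:E| = \int[Q]_x (trunc_obs w x)%:E)%E.
  apply: eq_integral => x _; rewrite gee0_abs// lee_fin.
  by have /andP[] := trunc_obs_ge0_le w x.
rewrite /Rintegral -absE (ae_eq_integral_abs (mu w) measurableT mE).2//.
apply/ae_nu_ae_mu => //; apply/(ae_eq_integral_abs (nu w) measurableT mE).
rewrite absE -[LHS]fineK; last first.
  exact: (integrable_fin_num measurableT (trunc_obs_integrable_nu w)).
by congr EFin.
Qed.

End RandomFibers.

(** * From good fibers to almost every base point *)

Lemma measurable_fun_section {d1 d2 d3 : measure_display}
    {X : measurableType d1} {Y : measurableType d2} {Z : measurableType d3}
    (D : set Y) (F : X * Y -> Z) (x : X) : measurable D ->
  measurable_fun ([set: X] `*` D) F -> measurable_fun D (fun y => F (x, y)).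
Proof.
move=> mD mF; apply: (@measurable_comp _ _ _ _ _ _ ([set: X] `*` D) F D (pair x)) => //.
- exact: measurableX.
- by move=> _ [y Dy <-].
- exact: measurable_funTS.
Qed.

Theorem theorem7p5 (R : realType) (d : measure_display)
  (Omega : topMeasurableType d) (m : probability Omega R)
  (sigma : Omega -> Omega) (T g : Omega -> R -> R)
  (nu : R.-pker Omega ~> R) (phi : Omega -> R -> R)
  (mu : Omega -> probability R R)
  (Hsys : closed_random_system m sigma T g nu phi mu)
  (Hadm : admissible m sigma T g nu phi mu)
  (v : Omega -> R -> R) (M : R)
  (v_ge0 : forall (w : Omega) (x : R), 0 <= x <= 1 -> 0 <= v w x)
  (v_meas : measurable_fun ([set: Omega] `*` (`[0, 1]%classic : set R))
              (fun z : Omega * R => v z.1 z.2))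
  (v_bound : (ess_sup m (fun w => B_norm (nu w) (v w)) <= M%:E)%E)
  (E_diverges : {ae m, forall w,
     expected_sum sigma mu v w n @[n --> \oo] --> +oo}) :
  {ae m, forall w, {ae mu w, forall x : R, 0 <= x <= 1 ->
     (expected_sum sigma mu v w n)^-1 *
       (\sum_(k < n) v (iter k sigma w) (cocycle sigma T k w x))
     @[n --> \oo] --> (1 : R)}}.
Proof.
have [tau [sK tK msigma mtau]] := base_invertible Hsys.
have sigma_mp := base_preserving Hsys.
have tau_mp : measure_preserving m tau.
  move=> A mA; rewrite -sigma_mp; last first.
    by rewrite -[X in measurable X]setTI; exact: mtau.
  by congr (m _); apply/seteqP; split => w /=; rewrite sK.
have [[_ mbase _] _ _ [_ [kappa [C [_ kappa01 C0 _ [_ phi_ge decay]]]]]] := Hadm.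
pose I01 : set R := `[0, 1]%classic.
have mI : measurable I01 by exact: measurable_itv.
have mT w : measurable_fun I01 (T w).
  have mTj : measurable_fun ([set: Omega] `*` I01) (fun z : Omega * R => T z.1 z.2).
    exact: measurableT_comp measurable_snd mbase.
  exact: (measurable_fun_section w mI mTj).
have TI w x : I01 x -> I01 (T w x).
  by move=> Ix; rewrite /I01 -(fiber_surjective Hsys w); exists x.
have mv w : measurable_fun I01 (v w) by exact: (measurable_fun_section w mI v_meas).
have v0 w x : I01 x -> 0 <= v w x.
  by rewrite /I01 /= in_itv/= => Ix; exact: v_ge0.
have good : {ae m, forall w, good_fiber sigma T nu phi mu v C kappa M w}.
  have vM : {ae m, forall w, (B_norm (nu w) (v w) <= M%:E)%E} by exact/ess_supP.
  near=> w; split; near: w.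
  - exact: nu_interval Hsys.
  - exact: phi_measurable Hsys.
  - exact: phi_ge.
  - exact: mu_density Hsys.
  - exact: decay.
  - exact: vM.
(* Two applications of [ae_iter], to the past under [tau] and then along the future under
   [sigma]. *)
have good_orbit : {ae m, forall w k j,
    good_fiber sigma T nu phi mu v C kappa M (iter j tau (iter k sigma w))}.
  exact: (ae_iter msigma sigma_mp (ae_iter mtau tau_mp good)).
pose obs w := \int[nu w]_x trunc_obs v M w x.
have mobs : measurable_fun setT obs.
  have mU : measurable_fun [set: Omega * R] (fun z => trunc_obs v M z.1 z.2).
    have := (measurable_restrictT (fun z : Omega * R => Num.min (v z.1 z.2) (`|M| + 1))
      (measurableX (@measurableT _ Omega) mI)).1 (measurable_minr v_meas (measurable_cst _)).
    congr measurable_fun; apply/funext => -[w x].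
    by rewrite /trunc_obs !patchE in_setX in_setT.
  apply: measurableT_comp; first exact: fine_measurable.
  apply: (@measurable_fun_integral_finite_kernel _ _ _ _ _
    (fun z => (trunc_obs v M z.1 z.2)%:E) nu).
    by move=> z; rewrite lee_fin; have /andP[] := trunc_obs_ge0_le M v0 z.1 z.2.
  exact/measurable_EFinP.
have obsB w : 0 <= obs w <= `|M| + 1 := Rintegral_nu_obs_ge0_le nu M mv v0 w.
(* Otherwise the nu-means vanish along almost every orbit, hence so do the mu-means, and every
   [expected_sum] is 0, against its divergence. *)
have obs_pos : 0 < \int[m]_w obs w.
  rewrite ltNge; apply/negP => obs_le0.
  have obs_norm w : `|obs w| <= `|M| + 1.
    by have /andP[? ?] := obsB w; rewrite ger0_norm.
  have obs_fin := integrable_fin_num measurableT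
    (bounded_fun_integrable m mobs obs_norm).
  have obs0 : {ae m, forall w, obs w = 0}.
    have mEobs : measurable_fun setT (EFin \o obs) by exact/measurable_EFinP.
    have := (ae_eq_integral_abs m measurableT mEobs).1.
    have -> : (\int[m]_w `|(EFin \o obs) w| = \int[m]_w (obs w)%:E)%E.
      by apply: eq_integral => w _; rewrite /= ger0_norm//; have /andP[] := obsB w.
    have -> : (\int[m]_w (obs w)%:E = 0)%E.
      rewrite -(fineK obs_fin); congr EFin; apply/eqP; rewrite eq_le obs_le0/=.
      by apply: Rintegral_ge0 => w _; have /andP[] := obsB w.
    by move=> /(_ erefl); apply: filterS => w /(_ I) [].
  have : {ae m, forall w, False}.
    apply: filterS3 (ae_iter msigma sigma_mp obs0) good_orbit E_diverges.
    move=> w ow gw /cvgryPge/(_ 1)[N _ /(_ N (leqnn N))] /=.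
    rewrite (expected_sumE mv gw) big1 ?ler10// => k _.
    exact: (Rintegral_nu_eq0 mv v0 (gw k 0%N) (ow k)).
  move=> [A [mA A0 subA]]; have AT : A = setT.
    by apply/seteqP; split => // w _; apply: subA.
  have := probability_setT m; rewrite -AT => A1.
  by move/eqP: (etrans (esym A1) A0); rewrite eqe oner_eq0.
have lower := ergodic_liminf_average msigma sigma_mp (base_ergodic Hsys)
  mobs obsB obs_pos.
apply: filterS2 good_orbit lower => w gw [c c0 [N cN]].
have := orbit_strong_law C0 kappa01 tK mT TI mv v0 gw.
apply: filterS => x lim0 /= x01.
have {}lim0 := lim0 ltac:(by rewrite /= in_itv).
(* The mu-means dominate [C^-1] times the nu-means, whose Birkhoff sums are eventually at least [c]
   times n. *)
apply: (ratio_cvg1 (c := C^-1 * c)) lim0; first by rewrite mulr_gt0// invr_gt0.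
exists N => // n /= Nn; rewrite -mulrA (expected_sumE mv gw).
apply: le_trans (ler_wpM2l _ (cN n Nn)) _; first by rewrite invr_ge0 ltW.
rewrite mulr_sumr; apply: ler_sum => k _.
exact: (Rintegral_nu_le_mu C0 mv v0 (gw k 0%N)).
Unshelve. all: by end_near. Qed.
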